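(* Let $B=\{b_1,\ldots,b_n\}\subseteq\mathbb{Z}^m$ be a finite supernormal vector configuration, and let $J_B\subseteq k[x_1,\ldots,x_n]$ be its binomial ideal. Then the chamber complex of $B$ coincides with the Gr\''obner fan of $J_B$; that is, for all $w,w'\in\mathrm{cone}(B)$ we have $in_w(J_B)=in_{w'}(J_B)$ if and only if for every subset $B'\subseteq B$ it holds that $w\in\mathrm{cone}(B')\iff w'\in\mathrm{cone}(B')$.
   Context: $k$ is a field. For a finite set $C\subseteq\mathbb{R}^m$, $\mathrm{cone}(C)$ denotes the set of non-negative real linear combinations of elements of $C$. The configuration $B$ is supernormal if for every subset $B'\subseteq B$, every lattice point in $\mathrm{cone}(B')\cap\mathbb{Z}^m$ is a non-negative integer combination of the elements of $B\cap\mathrm{cone}(B')$. The ideal $J_B$ is the ideal of $k[x_1,\ldots,x_n]$ generated by the binomials $\prod_{i:\,u\cdot b_i>0}x_i^{u\cdot b_i}-\prod_{j:\,u\cdot b_j<0}x_j^{-u\cdot b_j}$ for $u\in\mathbb{Z}^m$. For $w\in\mathrm{cone}(B)$, the initial ideal $in_w(J_B)$ is the ideal generated by the monomials $\prod_{i:\,u\cdot b_i>0}x_i^{u\cdot b_i}$ for all $u\in\mathbb{Z}^m$ with $u\cdot w>0$, together with the binomials $\prod_{i:\,u\cdot b_i>0}x_i^{u\cdot b_i}-\prod_{j:\,u\cdot b_j<0}x_j^{-u\cdot b_j}$ for all $u\in\mathbb{Z}^m$ with $u\cdot w=0$. The Gr\''obner fan of $J_B$ is the partition of $\mathrm{cone}(B)$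 in which $w,w'$ lie in the same cell iff $in_w(J_B)=in_{w'}(J_B)$; the chamber complex of $B$ is the partition of $\mathrm{cone}(B)$ in which $w,w'$ lie in the same cell iff they lie in exactly the same cones $\mathrm{cone}(B')$, $B'\subseteq B$. *)

(* Defs.v *)
From HB Require Import structures.
From mathcomp Require Import all_boot all_order all_algebra.
From mathcomp Require Import mpoly.
From mathcomp Require Import boolp classical_sets reals.

Set Implicit Arguments.
Unset Strict Implicit.
Unset Printing Implicit Defensive.

Import Order.TTheory GRing.Theory Num.Theory.

Local Open Scope classical_set_scope.
Local Open Scope ring_scope.

Definition dot (S : pzRingType) (m : nat) (u v : 'rV[S]_m) : S :=
  \sum_(j < m) u 0 j * v 0 j.

Definition realvec (R : realType) (m : nat) (z : 'rV[int]_m) : 'rV[R]_m :=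
  map_mx (fun a : int => a%:~R) z.

(* A configuration {b_1, ..., b_n} is a labelling b : 'I_n -> 'rV[int]_m, assumed
   injective in the theorem; a subset B' of B is the set A of its labels. *)
Definition cone (R : realType) (m n : nat) (b : 'I_n -> 'rV[int]_m)
    (A : {set 'I_n}) : set 'rV[R]_m :=
  [set w | exists c : 'I_n -> R,
     (forall i, 0 <= c i) /\ w = \sum_(i in A) c i *: realvec R (b i)].

Definition supernormal (R : realType) (m n : nat) (b : 'I_n -> 'rV[int]_m) : Prop :=
  forall (A : {set 'I_n}) (z : 'rV[int]_m),
    cone b A (realvec R z) ->
    exists c : 'I_n -> nat,
      (forall i, ~ cone b A (realvec R (b i)) -> c i = 0%N) /\
      z = \sum_(i < n) b i *+ c i.

Definition ideal_gen (S : comPzRingType) (G : set S) : set S :=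
  [set p | exists s : seq (S * S),
     (forall q, q \in s -> G q.2) /\ p = \sum_(q <- s) q.1 * q.2].

Definition pos_monomial (k : fieldType) (m n : nat) (b : 'I_n -> 'rV[int]_m)
    (u : 'rV[int]_m) : {mpoly k[n]} :=
  \prod_(i < n | 0 < dot u (b i)) 'X_i ^+ `|dot u (b i)|%N.

Definition neg_monomial (k : fieldType) (m n : nat) (b : 'I_n -> 'rV[int]_m)
    (u : 'rV[int]_m) : {mpoly k[n]} :=
  \prod_(j < n | dot u (b j) < 0) 'X_j ^+ `|- dot u (b j)|%N.

Definition lattice_binomial (k : fieldType) (m n : nat) (b : 'I_n -> 'rV[int]_m)
    (u : 'rV[int]_m) : {mpoly k[n]} :=
  pos_monomial k b u - neg_monomial k b u.

Definition binomial_ideal (k : fieldType) (m n : nat) (b : 'I_n -> 'rV[int]_m) :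
    set {mpoly k[n]} :=
  ideal_gen [set lattice_binomial k b u | u in setT].
Arguments binomial_ideal k {m n} b.

(* in_w(J_B), meant for w in cone(B): writing w = sum_i l_i b_i with l_i >= 0,
   u.w is the l-weight of the positive monomial minus that of the negative one,
   so the generators are the initial forms of the binomials for the weight l. *)
Definition initial_ideal (k : fieldType) (R : realType) (m n : nat)
    (b : 'I_n -> 'rV[int]_m) (w : 'rV[R]_m) : set {mpoly k[n]} :=
  ideal_gen ([set pos_monomial k b u | u in [set u | 0 < dot (realvec R u) w]] `|`
             [set lattice_binomial k b u | u in [set u | dot (realvec R u) w = 0]]).
Arguments initial_ideal k {R m n} b w.

Lemma initial_ideal0 (k : fieldType) (R : realType) (m n : nat)
    (b : 'I_n -> 'rV[int]_m) :
  initial_ideal k b (0 : 'rV[R]_m) = binomial_ideal k b.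
Proof.
have d0 u : dot (realvec R u) (0 : 'rV[R]_m) = 0.
  by rewrite /dot big1 // => j _; rewrite [X in _ * X]mxE mulr0.
rewrite /initial_ideal /binomial_ideal; congr ideal_gen.
apply/seteqP; split=> p.
- by case=> -[u /= u0 <-]; [rewrite d0 ltxx in u0 | exists u].
- by case=> u _ <-; right; exists u => /=.
Qed.

Definition groebner_cell (k : fieldType) (R : realType) (m n : nat)
    (b : 'I_n -> 'rV[int]_m) (w : 'rV[R]_m) : set 'rV[R]_m :=
  [set w' | cone b [set: 'I_n]%SET w' /\ initial_ideal k b w = initial_ideal k b w'].
Arguments groebner_cell k {R m n} b w.

Definition groebner_fan (k : fieldType) (R : realType) (m n : nat)
    (b : 'I_n -> 'rV[int]_m) : set (set 'rV[R]_m) :=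
  [set groebner_cell k b w | w in cone b [set: 'I_n]%SET].
Arguments groebner_fan k R {m n} b.

Definition chamber (R : realType) (m n : nat)
    (b : 'I_n -> 'rV[int]_m) (w : 'rV[R]_m) : set 'rV[R]_m :=
  [set w' | cone b [set: 'I_n]%SET w' /\
            forall A : {set 'I_n}, cone b A w <-> cone b A w'].

Definition chamber_complex (R : realType) (m n : nat)
    (b : 'I_n -> 'rV[int]_m) : set (set 'rV[R]_m) :=
  [set chamber b w | w in cone b [set: 'I_n]%SET].
Arguments chamber_complex R {m n} b.

(* Main.v *)
Require Import Defs.
From HB Require Import structures.
From mathcomp Require Import all_boot all_order all_algebra.
From mathcomp Require Import mpoly.
From mathcomp Require Import boolp classical_sets reals.
From mathcomp Require Import zify ring lra.

Set Implicit Arguments.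
Unset Strict Implicit.
Unset Printing Implicit Defensive.

Import Order.TTheory GRing.Theory Num.Theory.

Local Open Scope classical_set_scope.
Local Open Scope ring_scope.

(* The ideal in_w(J_B) contains a monomial supported off A exactly when w is not
   in cone(A): rational Farkas gives the monomial, and otherwise evaluating at a
   0/1 point separates; so in_w(J_B) determines the chamber of w.  Conversely, if
   w and w' lie in the same chamber and u.w > 0, then w', like w, is not in the
   cone of the b_i with u.b_i <= 0.  Hence w' takes a negative value on the
   polyhedron P of the v with v.b_i >= - max(u.b_i, 0).  Since 0 and -u lie in P,
   every b_j in the cone of the normals active at a point of P is active there as
   well, so supernormality makes the minimal faces of P contain lattice points.
   A lattice point x of P with x.w' < 0 gives a generator of in_w'(J_B) dividing
   x^(u+).  When u.w = 0 but u.w' <> 0, this applies to both u and -u. *)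

Lemma dotDl (S : pzRingType) m (u v w : 'rV[S]_m) :
  dot (u + v) w = dot u w + dot v w.
Proof. by rewrite /dot -big_split; apply: eq_bigr => j _; rewrite mxE mulrDl. Qed.

Lemma dotDr (S : pzRingType) m (u v w : 'rV[S]_m) :
  dot u (v + w) = dot u v + dot u w.
Proof. by rewrite /dot -big_split; apply: eq_bigr => j _; rewrite mxE mulrDr. Qed.

Lemma dotZl (S : pzRingType) m a (u v : 'rV[S]_m) : dot (a *: u) v = a * dot u v.
Proof. by rewrite /dot mulr_sumr; apply: eq_bigr => j _; rewrite mxE mulrA. Qed.

Lemma dotZr (S : comPzRingType) m a (u v : 'rV[S]_m) : dot u (a *: v) = a * dot u v.
Proof. by rewrite /dot mulr_sumr; apply: eq_bigr => j _; rewrite mxE mulrCA. Qed.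

Lemma dotNl (S : pzRingType) m (u v : 'rV[S]_m) : dot (- u) v = - dot u v.
Proof. by rewrite -scaleN1r dotZl mulN1r. Qed.

Lemma dotNr (S : comPzRingType) m (u v : 'rV[S]_m) : dot u (- v) = - dot u v.
Proof. by rewrite -scaleN1r dotZr mulN1r. Qed.

Lemma dot0r (S : comPzRingType) m (u : 'rV[S]_m) : dot u 0 = 0.
Proof. by rewrite -(scale0r 0) dotZr mul0r. Qed.

Lemma dot0l (S : pzRingType) m (u : 'rV[S]_m) : dot 0 u = 0.
Proof. by rewrite -(scale0r 0) dotZl mul0r. Qed.

Lemma dot_sumr (S : comPzRingType) m (u : 'rV[S]_m) I (r : seq I) P F :
  dot u (\sum_(i <- r | P i) F i) = \sum_(i <- r | P i) dot u (F i).
Proof. exact: (big_morph (dot u) (@dotDr _ _ u) (dot0r u)). Qed.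

Lemma dot_realvec (R : realType) m (u v : 'rV[int]_m) :
  dot (realvec R u) (realvec R v) = (dot u v)%:~R.
Proof. by rewrite /dot rmorph_sum; apply: eq_bigr => j _; rewrite !mxE rmorphM. Qed.

Lemma realvecN (R : realType) m (u : 'rV[int]_m) : realvec R (- u) = - realvec R u.
Proof. by rewrite /realvec map_mxN. Qed.

Lemma realvecD (R : realType) m (u v : 'rV[int]_m) :
  realvec R (u + v) = realvec R u + realvec R v.
Proof. by rewrite /realvec map_mxD. Qed.

Lemma realvecZ (R : realType) m a (u : 'rV[int]_m) :
  realvec R (a *: u) = a%:~R *: realvec R u.
Proof. by rewrite /realvec map_mxZ. Qed.

Lemma fourier_motzkin (R : realType) m (us : seq 'rV[int]_m) (z : 'rV[int]_m) :
  exists us' : seq 'rV[int]_m, forall w : 'rV[R]_m,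
    (exists2 t, 0 <= t &
       forall u, u \in us -> 0 <= dot (realvec R u) (w - t *: realvec R z)) <->
    (forall u, u \in us' -> 0 <= dot (realvec R u) w).
Proof.
exists ([seq u <- us | 0 <= dot u z] ++
  [seq dot p z *: q - dot q z *: p | p <- [seq u <- us | 0 < dot u z],
                                     q <- [seq u <- us | dot u z < 0]]) => w.
have E u t : dot (realvec R u) (w - t *: realvec R z) =
    dot (realvec R u) w - t * (dot u z)%:~R.
  by rewrite dotDr dotNr dotZr dot_realvec.
split=> [[t t0 tP] u|H].
- rewrite mem_cat => /orP[|/allpairsP[[p q] /= []]].
  + rewrite mem_filter => /andP[uz /tP]; rewrite E => h.
    have : 0 <= t * (dot u z)%:~R by rewrite mulr_ge0 // ler0z.
    lra.
  + rewrite !mem_filter => /andP[pz /tP]; rewrite E => hp.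
    move=> /andP[qz /tP]; rewrite E => hq ->.
    rewrite realvecD realvecN !realvecZ dotDl dotNl !dotZl.
    have {}pz : 0 < (dot p z)%:~R :> R by rewrite ltr0z.
    have {}qz : (dot q z)%:~R < 0 :> R by rewrite ltrz0.
    nra.
- pose F u : R := dot (realvec R u) w / (dot u z)%:~R.
  exists (\big[Num.max/0]_(u <- us | dot u z < 0) F u).
    exact: bigmax_ge_id.
  set t := \big[_/_]_(_ <- _ | _) _.
  move=> u uin; rewrite E.
  have [uz|uz|uz] := ltrgt0P (dot u z).
  + have uz' : 0 < (dot u z)%:~R :> R by rewrite ltr0z.
    rewrite subr_ge0 -ler_pdivlMr // /t.
    rewrite big_seq_cond.
    elim/big_ind: _ => [|x y hx hy|q /andP[qin qz]].
    * by rewrite divr_ge0 ?(ltW uz') // H // mem_cat mem_filter (ltW uz) uin.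
    * by rewrite ge_max hx.
    * have qz' : (dot q z)%:~R < 0 :> R by rewrite ltrz0.
      rewrite /F ler_ndivrMr // mulrAC ler_pdivrMr // -subr_ge0.
      have := H (dot u z *: q - dot q z *: u).
      rewrite realvecD realvecN !realvecZ dotDl dotNl !dotZl => h.
      rewrite [_ * (dot u z)%:~R]mulrC [_ * (dot q z)%:~R]mulrC h //.
      rewrite mem_cat; apply/orP; right; apply/allpairsP; exists (u, q).
      by rewrite /= !mem_filter uz uin qz qin.
  + have uz' : (dot u z)%:~R < 0 :> R by rewrite ltrz0.
    rewrite subr_ge0 -ler_ndivrMr //.
    by rewrite -/(F u); exact: (@le_bigmax_seq _ R _ us 0 u (fun u => dot u z < 0) F).
  + rewrite uz mulr0 subr0 H // mem_cat mem_filter uz lexx uin //.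
Qed.

Lemma int_solvable (K : numFieldType) n m (M : 'M[int]_(n, m)) (c : 'cV[int]_n) :
  (forall (y : 'rV[K]_n) (z : 'rV[int]_m),
     y *m map_mx intr M = map_mx intr z ->
     exists a : int, y *m map_mx intr c = a%:~R%:M) ->
  exists x : 'cV[int]_m, M *m x = c.
Proof.
have [L uL [Q uQ [d _ ->]]] := int_Smith_normal_form M.
set D := \matrix_(i, j) _ => H.
pose c' := invmx L *m c.
have Hc k (g : int) (z : 'rV[int]_m) : g != 0 -> row k D = g *: z ->
    exists a, c' k 0 = g * a.
  move=> g0 kD.
  have g0' : g%:~R != 0 :> K by rewrite intr_eq0.
  have [|a Ha] := H (g%:~R^-1 *: map_mx intr (row k (invmx L))) (z *m Q).
    rewrite -scalemxAl -map_mxM -row_mul -mulmxA mulKmx // row_mul kD.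
    by rewrite -scalemxAl map_mxZ scalerA mulVf // scale1r.
  exists a; apply/(intr_inj (R := K)).
  move: Ha; rewrite -scalemxAl -map_mxM -row_mul -/c' => /matrixP/(_ 0 0).
  rewrite !mxE eqxx mulr1n intrM => <-.
  by rewrite mulrA divff // mul1r.
pose x' : 'cV[int]_m :=
  \col_j (if insub (j : nat) is Some k then (c' k 0%R %/ d`_k)%Z else 0).
exists (invmx Q *m x').
rewrite -!mulmxA mulKVmx // (_ : D *m x' = c') ?mulKVmx //.
have c'0 k : row k D = 0 -> c' k 0 = 0.
  move=> kD; apply/eqP; apply: contraT => c0.
  have [|a Ha] := Hc k (c' k 0 * 2) 0 _ (etrans kD (esym (scaler0 _ _))).
    by rewrite mulf_neq0.
  have /eqP : c' k 0 * (1 - 2 * a) = 0 by rewrite mulrBr mulr1 mulrA -Ha subrr.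
  rewrite mulf_eq0 (negPf c0) /= => /eqP; lia.
clearbody c'; apply/colP => k; rewrite mxE.
have [km|km] := ltnP k m.
- rewrite (bigD1 (Ordinal km)) //= big1 => [|j jk]; last first.
    rewrite !mxE (_ : (k == j :> nat) = false) ?mulr0n ?mul0r //.
    by apply/negbTE; apply: contraNneq jk => kj; apply/eqP/val_inj.
  rewrite !mxE eqxx mulr1n addr0 /= valK.
  have rk : row k D = d`_k *: delta_mx 0 (Ordinal km).
    apply/rowP => j; rewrite !mxE eqxx /= mulr_natr; congr (_ *+ _).
    by rewrite eq_sym.
  have [d0|d0] := eqVneq d`_k 0.
    by rewrite d0 mul0r c'0 // rk d0 scale0r.
  by have [a ->] := Hc _ _ _ d0 rk; rewrite [in (_ %/ _)%Z]mulrC mulzK.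
- rewrite big1 => [|j _].
    rewrite c'0 //; apply/rowP => j; rewrite !mxE.
    by rewrite gtn_eqF // (leq_trans (ltn_ord j)).
  by rewrite !mxE gtn_eqF ?mulr0n ?mul0r // (leq_trans (ltn_ord j)).
Qed.

Lemma dot_delta (R : realType) m (j : 'I_m) (w : 'rV[R]_m) :
  dot (realvec R (delta_mx 0 j)) w = w 0 j.
Proof.
rewrite /dot (bigD1 j) //= big1 => [|i /negPf ij].
  by rewrite !mxE !eqxx mul1r addr0.
by rewrite !mxE ij andbF mul0r.
Qed.

Lemma cone_halfspaces (R : realType) m n (b : 'I_n -> 'rV[int]_m) (A : {set 'I_n}) :
  exists us : seq 'rV[int]_m, forall w : 'rV[R]_m,
    cone b A w <-> (forall u, u \in us -> 0 <= dot (realvec R u) w).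
Proof.
rewrite /cone /=.
under eq_exists => us.
  under eq_forall => w.
    under eq_exists => c do rewrite -big_enum /=.
    over.
  over.
elim: (enum A) (enum_uniq A) => [_|i s IHs /= /andP[is_ us]].
  pose us := codom (fun j : 'I_m => delta_mx 0 j : 'rV[int]_m).
  exists (us ++ [seq - u | u <- us]) => w; split=> [[c [_ ->]] u _|H].
    by rewrite big_nil dot0r.
  exists (fun=> 0); split=> //; rewrite big_nil; apply/rowP => j; rewrite mxE.
  have jus : delta_mx 0 j \in us by exact: codom_f.
  apply/le_anti/andP; split; rewrite -(dot_delta j w); last first.
    by rewrite H // mem_cat jus.
  by rewrite -oppr_ge0 -dotNl -realvecN H // mem_cat map_f ?orbT.
have [vs Hvs] := IHs us.
have [vs' Hvs'] := fourier_motzkin R vs (b i).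
exists vs' => w; rewrite -Hvs'; split=> [[c [c0 wE]]|[t t0 /Hvs[c [c0 wE]]]].
  exists (c i) => //; apply/Hvs; exists c; split=> //.
  by rewrite wE big_cons addrC addrK.
exists (fun j => if j == i then t else c j); split=> [j|].
  by case: ifP.
rewrite big_cons eqxx; apply/eqP; rewrite addrC -subr_eq; apply/eqP.
rewrite wE !big_seq; apply: eq_bigr => j js.
by case: eqP => // ji; rewrite -ji js in is_.
Qed.

Lemma cone_gen (R : realType) m n (b : 'I_n -> 'rV[int]_m) (A : {set 'I_n}) i :
  i \in A -> cone b A (realvec R (b i)).
Proof.
move=> iA; exists (fun j => (j == i)%:R); split=> [j|]; first exact: ler0n.
rewrite (bigD1 i) //= eqxx scale1r big1 ?addr0 // => j /andP[_ /negPf->].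
by rewrite scale0r.
Qed.

Lemma cone_dot_ge0 (R : realType) m n (b : 'I_n -> 'rV[int]_m) (A : {set 'I_n})
    (w v : 'rV[R]_m) :
  cone b A w -> (forall i, i \in A -> 0 <= dot v (realvec R (b i))) -> 0 <= dot v w.
Proof.
move=> [c [c0 ->]] H; rewrite dot_sumr sumr_ge0 // => i iA.
by rewrite dotZr mulr_ge0 ?H.
Qed.

Lemma cone_farkas (R : realType) m n (b : 'I_n -> 'rV[int]_m) (A : {set 'I_n})
    (w : 'rV[R]_m) :
  ~ cone b A w -> exists u : 'rV[int]_m,
    (forall i, i \in A -> 0 <= dot u (b i)) /\ dot (realvec R u) w < 0.
Proof.
have [us H] := cone_halfspaces R b A.
move=> /H/existsNP[u /not_implyP[uin /negP]]; rewrite -ltNge => uw.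
exists u; split=> // i iA.
by have /H/(_ _ uin) := cone_gen R b iA; rewrite dot_realvec ler0z.
Qed.

(* Among the points of the polyhedron on which [w] is negative, take one with
   the most active constraints: moving along a direction orthogonal to these
   would activate a further one. *)
Lemma max_active (R : realType) m n (g : 'I_n -> 'rV[R]_m) (a : 'I_n -> R)
    (w v0 : 'rV[R]_m) :
  (forall d, (forall i, 0 <= dot d (g i)) -> 0 <= dot d w) ->
  (forall i, a i <= dot v0 (g i)) -> dot v0 w < 0 ->
  exists v, [/\ forall i, a i <= dot v (g i), dot v w < 0 &
    forall d, (forall i, dot v (g i) = a i -> dot d (g i) = 0) ->
              forall i, dot d (g i) = 0].
Proof.
move=> wge0 v0a v0w.
pose act v := [set i | dot v (g i) == a i]%SET.
pose feas v := (forall i, a i <= dot v (g i)) /\ dot v w < 0.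
pose P k := `[< exists v, feas v /\ #|act v| = k >].
have exP : exists k, P k by exists #|act v0|; apply/asboolP; exists v0.
have ubP k : P k -> (k <= n)%N.
  by move=> /asboolP[v [_ <-]]; rewrite -[X in (_ <= X)%N](card_ord n) max_card.
case: (ex_maxnP exP ubP) => _ /asboolP[v [[va vw] <-]] vmax.
exists v; split=> //.
have step d : (forall i, dot v (g i) = a i -> dot d (g i) = 0) ->
    dot d w <= 0 -> forall i, 0 <= dot d (g i).
  move=> d0 dw i0; rewrite leNgt; apply/negP => di0.
  pose F i := (dot v (g i) - a i) / - dot d (g i).
  have [j dj jmin] := @arg_minP _ R _ i0 (fun i => dot d (g i) < 0) F di0.
  have Fj0 : 0 <= F j by rewrite divr_ge0 ?subr_ge0 // oppr_ge0 ltW.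
  have E i : dot (v + F j *: d) (g i) = dot v (g i) + F j * dot d (g i).
    by rewrite dotDl dotZl.
  suff : (#|act (v + F j *: d)%R| <= #|act v|)%N.
    rewrite leqNgt => /negP; apply; apply/proper_card/properP; split.
      apply/fintype.subsetP => i; rewrite !inE => /eqP vi.
      by rewrite E vi d0 // mulr0 addr0.
    exists j; rewrite !inE.
      rewrite E /F invrN mulrN mulNr divfK ?ltr0_neq0 //; lra.
    by apply/negP => /eqP/d0 dj0; rewrite dj0 ltxx in dj.
  apply: vmax; apply/asboolP; exists (v + F j *: d); split=> //; split=> [i|].
    rewrite E; have [di|di] := ltP (dot d (g i)) 0.
      have := jmin _ di; rewrite [X in _ <= X]/F ler_pdivlMr ?oppr_gt0 //; lra.
    by have := va i; have := mulr_ge0 Fj0 di; lra.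
  by rewrite dotDl dotZl; have := mulr_ge0_le0 Fj0 dw; lra.
have zero d : (forall i, dot v (g i) = a i -> dot d (g i) = 0) ->
    dot d w <= 0 -> forall i, dot d (g i) = 0.
  move=> d0 dw i.
  have dge0 := step d d0 dw.
  have : 0 <= dot (- d) (g i).
    apply: step; last by rewrite dotNl oppr_le0 wge0.
    by move=> i' /d0; rewrite dotNl => ->; rewrite oppr0.
  by rewrite dotNl oppr_ge0 => dle0; apply/le_anti; rewrite dle0 dge0.
move=> d d0; have [|dw i] := lerP (dot d w) 0; first exact: zero.
apply/oppr_inj; rewrite oppr0 -dotNl; apply: zero => [i' /d0|].
  by rewrite dotNl => ->; rewrite oppr0.
by rewrite dotNl oppr_le0 ltW.
Qed.

Lemma realvec_sum (R : realType) m I (r : seq I) P (F : I -> 'rV[int]_m) :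
  realvec R (\sum_(i <- r | P i) F i) = \sum_(i <- r | P i) realvec R (F i).
Proof.
by rewrite /realvec; apply: (big_morph _ (@realvecD R m)); apply: map_mx0.
Qed.

Lemma realvecMn (R : realType) m (u : 'rV[int]_m) k :
  realvec R (u *+ k) = k%:R *: realvec R u.
Proof. by rewrite -scaler_nat realvecZ rmorph_nat. Qed.

(* Supernormality makes the face of [v] integral: an integral combination of its
   active normals is, up to integral combinations of them, a nonnegative integral
   combination of generators active at [v]. *)
Lemma active_lattice_point (R : realType) m n (b : 'I_n -> 'rV[int]_m)
    (a : 'I_n -> int) (v : 'rV[R]_m) (I : {set 'I_n}) :
  supernormal R b ->
  (forall i, cone b I (realvec R (b i)) -> dot v (realvec R (b i)) = (a i)%:~R) ->
  exists x : 'rV[int]_m, forall i, i \in I -> dot x (b i) = a i.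
Proof.
move=> b_sn tight.
have tightI i : i \in I -> dot v (realvec R (b i)) = (a i)%:~R.
  by move=> iI; apply/tight/cone_gen.
pose M := \matrix_(i < n, j < m) (if i \in I then b i 0 j else 0).
pose c := \col_(i < n) (if i \in I then a i else 0).
have [y z yM|x Mx] := @int_solvable R _ _ M c; last first.
  exists x^T => i iI; have /colP/(_ i) := Mx; rewrite !mxE iI => <-.
  by apply: eq_bigr => j _; rewrite !mxE iI mulrC.
pose N i := Num.bound `|y 0 i|.
have yN i : 0 <= y 0 i + (N i)%:R.
  by have := archi_boundP (normr_ge0 (y 0 i)); rewrite -/(N i) ltr_norml; lra.
have zE : realvec R z = \sum_(i in I) y 0 i *: realvec R (b i).
  rewrite /realvec -yM; apply/rowP => j; rewrite summxE !mxE [RHS]big_mkcond.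
  apply: eq_bigr => i _; rewrite !mxE; by case: ifP => iI; rewrite ?mxE ?mulr0.
pose z' := z + \sum_(i in I) b i *+ N i.
have z'E : realvec R z' = \sum_(i in I) (y 0 i + (N i)%:R) *: realvec R (b i).
  rewrite realvecD zE realvec_sum -big_split; apply: eq_bigr => i _ /=.
  by rewrite realvecMn scalerDl.
have [|e [e0 z'e]] := b_sn I z'.
  by exists (fun i => y 0 i + (N i)%:R).
have eE : dot v (realvec R z') = (\sum_i a i *+ e i)%:~R.
  rewrite z'e realvec_sum dot_sumr rmorph_sum; apply: eq_bigr => i _ /=.
  rewrite realvecMn dotZr rmorphMn /= mulr_natl.
  by have [/tight->//|/e0->] := pselect (cone b I (realvec R (b i))).
exists (\sum_i a i *+ e i - \sum_(i in I) a i *+ N i).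
rewrite [LHS]mx11_scalar rmorphB /= -eE z'E dot_sumr rmorph_sum -sumrB.
congr (_%:M); rewrite !mxE [RHS]big_mkcond; apply: eq_bigr => i _.
rewrite !mxE; case: ifP => iI; last by rewrite mulr0.
by rewrite dotZr tightI // rmorphMn /= mulrDl mulr_natl addrK.
Qed.

Lemma lattice_descent (R : realType) m n (b : 'I_n -> 'rV[int]_m)
    (u : 'rV[int]_m) (w : 'rV[R]_m) :
  supernormal R b -> cone b [set: 'I_n]%SET w ->
  ~ cone b [set i | (dot u (b i) <= 0)%R]%SET w ->
  exists x : 'rV[int]_m,
    0 < dot (realvec R x) w /\ forall i, dot x (b i) <= Num.max (dot u (b i)) 0.
Proof.
move=> b_sn wB /cone_farkas[p [pge0 pw]].
pose a i : int := - Num.max (dot u (b i)) 0.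
pose g i := realvec R (b i).
have wge0 d : (forall i, 0 <= dot d (g i)) -> 0 <= dot d w.
  by move=> dge0; apply: cone_dot_ge0 wB _ => i _; apply: dge0.
pose N : nat := \sum_i `|dot p (b i)|%N.
pose v0 := (N.+1%:R^-1 : R) *: realvec R p.
have v0a i : (a i)%:~R <= dot v0 (g i).
  rewrite /v0 dotZl dot_realvec mulrC ler_pdivlMr ?ltr0Sn // -[N.+1%:R]/(N.+1%:~R).
  rewrite -intrM ler_int /a.
  have [ui|ui] := leP (dot u (b i)) 0.
    by rewrite oppr0 mul0r pge0 // inE.
  have : (`|dot p (b i)| <= N)%N by rewrite /N (bigD1 i) //= leq_addr.
  nia.
have v0w : dot v0 w < 0 by rewrite /v0 dotZl pmulr_rlt0 // invr_gt0 ltr0Sn.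
have [v [va vw vmax]] := max_active wge0 v0a v0w.
pose I := [set i | dot v (g i) == (a i)%:~R]%SET.
have tight i : cone b I (g i) -> dot v (g i) = (a i)%:~R.
  move=> iI; apply/le_anti; rewrite va andbT.
  have least q : (forall j, (a j)%:~R <= dot q (g j)) -> dot v (g i) <= dot q (g i).
    move=> qa; rewrite -subr_ge0 -dotNl -dotDl.
    apply: cone_dot_ge0 iI _ => j; rewrite inE => /eqP vj.
    by rewrite dotDl dotNl subr_ge0 vj.
  have l0 : dot v (g i) <= dot (realvec R 0) (g i).
    apply: least => j; rewrite dot_realvec ler_int /a.
    by rewrite dot0l oppr_le0 le_max lexx orbT.
  have lu : dot v (g i) <= dot (realvec R (- u)) (g i).
    apply: least => j; rewrite dot_realvec ler_int /a dotNl.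
    by rewrite lerN2 le_max lexx.
  move: l0 lu; rewrite !dot_realvec dotNl dot0l /a.
  by have [] := leP (dot u (b i)) 0; rewrite ?oppr0.
have [x xI] := active_lattice_point b_sn tight.
pose d := realvec R x - v.
have d0 : forall i, dot d (g i) = 0.
  apply: vmax => i vi.
  by rewrite /d dotDl dotNl vi dot_realvec xI ?subrr // inE vi.
have dw : dot d w = 0.
  apply/le_anti; rewrite -oppr_ge0 -dotNl !wge0 // => i; rewrite ?dotNl d0 //.
  by rewrite oppr0.
exists (- x); split=> [|i].
  rewrite realvecN dotNl oppr_gt0.
  by move: dw; rewrite /d dotDl dotNl => /eqP; rewrite subr_eq0 => /eqP->.
have := va i; have := d0 i; rewrite /d dotDl dotNl => /eqP.
by rewrite subr_eq0 => /eqP <-; rewrite dot_realvec ler_int /a dotNl lerNl.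
Qed.

Lemma ideal_gen_mem (S : comPzRingType) (G : set S) p : G p -> ideal_gen G p.
Proof.
move=> Gp; exists [:: (1, p)]; split=> [q|]; first by rewrite inE => /eqP->.
by rewrite big_seq1 mul1r.
Qed.

Lemma ideal_genD (S : comPzRingType) (G : set S) p q :
  ideal_gen G p -> ideal_gen G q -> ideal_gen G (p + q).
Proof.
move=> [s [sG ->]] [t [tG ->]]; exists (s ++ t); split; last by rewrite big_cat.
by move=> x; rewrite mem_cat => /orP[/sG|/tG].
Qed.

Lemma ideal_genM (S : comPzRingType) (G : set S) a p :
  ideal_gen G p -> ideal_gen G (a * p).
Proof.
move=> [s [sG ->]]; exists [seq (a * q.1, q.2) | q <- s]; split.
  by move=> _ /mapP[q /sG Gq ->].
by rewrite big_map mulr_sumr; apply: eq_bigr => q _; rewrite mulrA.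
Qed.

Lemma ideal_gen_sub (S : comPzRingType) (G H : set S) :
  G `<=` ideal_gen H -> ideal_gen G `<=` ideal_gen H.
Proof.
move=> GH _ [s [sG ->]]; rewrite big_seq; elim/big_ind: _ => [|p q|q /sG/GH].
- by exists [::]; split=> //; rewrite big_nil.
- exact: ideal_genD.
- exact: ideal_genM.
Qed.

Lemma ideal_gen_rmorph (S T : comPzRingType) (G : set S) (f : {rmorphism S -> T}) :
  (forall p, G p -> f p = 0) -> forall p, ideal_gen G p -> f p = 0.
Proof.
move=> fG _ [s [sG ->]]; rewrite rmorph_sum big_seq big1 // => q /sG/fG fq.
by rewrite rmorphM /= fq mulr0.
Qed.

Definition eval_off (k : fieldType) n (A : {set 'I_n}) : {rmorphism {mpoly k[n]} -> k} :=
  meval (fun i => (i \notin A)%:R).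

Lemma pos_monomialN (k : fieldType) m n (b : 'I_n -> 'rV[int]_m) u :
  pos_monomial k b (- u) = neg_monomial k b u.
Proof.
rewrite /pos_monomial /neg_monomial.
by apply: eq_big => [i|i _]; rewrite dotNl ?oppr_gt0.
Qed.

Lemma pos_monomial_dvd (k : fieldType) m n (b : 'I_n -> 'rV[int]_m)
    (u v : 'rV[int]_m) :
  (forall i, dot u (b i) <= Num.max (dot v (b i)) 0) ->
  exists q, pos_monomial k b v = q * pos_monomial k b u.
Proof.
move=> uv.
pose e i : nat := if 0 < dot u (b i) then `|dot u (b i)|%N else 0%N.
exists (\prod_i (if 0 < dot v (b i) then 'X_i ^+ (`|dot v (b i)| - e i)%N else 1)).
rewrite /pos_monomial big_mkcond [X in _ * X]big_mkcond -big_split /=.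
apply: eq_bigr => i _.
rewrite /e; have := uv i; case: (ltP 0 (dot v (b i))) => vi; case: ltP => ui h.
- by rewrite -exprD; congr (_ ^+ _); lia.
- by rewrite subn0 mulr1.
- by exfalso; lia.
- by rewrite mulr1.
Qed.

Lemma pos_monomial_eval_off (k : fieldType) m n (b : 'I_n -> 'rV[int]_m) A u :
  eval_off k A (pos_monomial k b u) =
  [forall i, (0 < dot u (b i)) ==> (i \notin A)]%:R.
Proof.
rewrite rmorph_prod /=.
have E i : 0 < dot u (b i) ->
    eval_off k A ('X_i ^+ `|dot u (b i)|%N) = (i \notin A)%:R.
  move=> ui; rewrite rmorphXn /= mevalXU.
  by case: (i \notin A); rewrite ?expr1n // expr0n absz_eq0 gt_eqF.
case: forallP => [uA|nuA].
  rewrite big1 // => i ui; rewrite E //.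
  by have := uA i; rewrite ui /= => ->.
apply/eqP/prodf_eq0.
have /existsNP[i /negP] := nuA.
by rewrite negb_imply => /andP[ui /negPf iA]; exists i => //; rewrite E // iA.
Qed.

(* If u.w > 0, some i with c i > 0 has u.b_i > 0; if u.w = 0, either u.b_i = 0 for
   all i with c i > 0, or both signs occur and both monomials vanish. *)
Lemma initial_ideal_eval_off (k : fieldType) (R : realType) m n (b : 'I_n -> 'rV[int]_m)
    (w : 'rV[R]_m) (c : 'I_n -> R) p :
  (forall i, 0 <= c i) -> w = \sum_i c i *: realvec R (b i) ->
  initial_ideal k b w p -> eval_off k [set i | 0 < c i]%SET p = 0.
Proof.
move=> c0 wE; apply: ideal_gen_rmorph => {}p.
have dw u : dot (realvec R u) w = \sum_i c i * (dot u (b i))%:~R.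
  by rewrite wE dot_sumr; apply: eq_bigr => i _; rewrite dotZr dot_realvec.
have posE u : (exists2 i, 0 < c i & 0 < dot u (b i)) ->
    eval_off k [set i | 0 < c i]%SET (pos_monomial k b u) = 0.
  move=> [i ci ui]; rewrite pos_monomial_eval_off; case: forallP => // /(_ i).
  by rewrite ui inE ci.
have posE1 u : (forall i, 0 < c i -> dot u (b i) <= 0) ->
    eval_off k [set i | 0 < c i]%SET (pos_monomial k b u) = 1.
  move=> uc; rewrite pos_monomial_eval_off; case: forallP => // -[] i.
  by apply/implyP => ui; rewrite inE; apply/negP => /uc; rewrite leNgt ui.
have le0 u : (forall i, 0 < c i -> dot u (b i) <= 0) ->
    forall i, c i * (dot u (b i))%:~R <= 0.
  move=> uc i; have := c0 i; rewrite le_eqVlt => /orP[/eqP<-|ci].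
    by rewrite mul0r.
  by rewrite pmulr_rle0 // lerz0 uc.
have ex u : ~ (forall i, 0 < c i -> dot u (b i) <= 0) ->
    exists2 i, 0 < c i & 0 < dot u (b i).
  by move=> /existsNP[i /not_implyP[ci /negP]]; rewrite -ltNge; exists i.
case=> [[u /= uw <-]|[u /= uw <-]].
  apply/posE/ex => /le0 uc; move: uw; rewrite dw ltNge => /negP; apply.
  exact: sumr_le0.
rewrite rmorphB /= -pos_monomialN.
have eq0 v : dot (realvec R v) w = 0 -> (forall i, 0 < c i -> dot v (b i) <= 0) ->
    forall i, 0 < c i -> dot (- v) (b i) <= 0.
  move=> vw vc i ci; rewrite dotNl oppr_le0 -(ler0z R) -(pmulr_rge0 _ ci).
  rewrite -oppr_le0; have : \sum_i - (c i * (dot v (b i))%:~R) = 0.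
    by rewrite sumrN -dw vw oppr0.
  by move=> /psumr_eq0P -> // i' _; rewrite oppr_ge0 le0.
have [uc|uc] := pselect (forall i, 0 < c i -> dot u (b i) <= 0).
  by rewrite !posE1 ?subrr //; apply: eq0.
rewrite !posE ?subrr //; apply: ex => // uc'; apply: uc.
rewrite -[u]opprK; apply: eq0 => //.
by rewrite realvecN dotNl uw oppr0.
Qed.

Lemma cone_initial_ideal (k : fieldType) (R : realType) m n (b : 'I_n -> 'rV[int]_m)
    (w w' : 'rV[R]_m) (A : {set 'I_n}) :
  initial_ideal k b w = initial_ideal k b w' -> cone b A w -> cone b A w'.
Proof.
move=> ww' [c [c0 wE]]; apply: contrapT => /cone_farkas[u [uA uw']].
pose c' i := if i \in A then c i else 0.
have /(initial_ideal_eval_off _ _) : initial_ideal k b w (pos_monomial k b (- u)).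
  rewrite ww'; apply: ideal_gen_mem; left; exists (- u) => //=.
  by rewrite realvecN dotNl oppr_gt0.
move=> /(_ c'); rewrite pos_monomial_eval_off.
case: forallP => [_ H|[] i].
  suff /eqP : 1 = 0 :> k by rewrite oner_eq0.
  apply: H => [i|].
    by rewrite /c'; case: ifP.
  rewrite wE big_mkcond; apply: eq_bigr => i _.
  by rewrite /c'; case: ifP; rewrite ?scale0r.
apply/implyP; rewrite dotNl oppr_gt0 inE /c'; case: ifP => [/uA|]; last first.
  by rewrite ltxx.
by rewrite leNgt => /negP.
Qed.

Lemma initial_ideal_sub (k : fieldType) (R : realType) m n (b : 'I_n -> 'rV[int]_m)
    (w w' : 'rV[R]_m) :
  supernormal R b -> cone b [set: 'I_n]%SET w' ->
  (forall A : {set 'I_n}, cone b A w <-> cone b A w') ->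
  initial_ideal k b w `<=` initial_ideal k b w'.
Proof.
move=> b_sn w'B ww'.
have pos u : ~ cone b [set i | (dot u (b i) <= 0)%R]%SET w' ->
    initial_ideal k b w' (pos_monomial k b u).
  move=> /(lattice_descent b_sn w'B)[x [xw' /(@pos_monomial_dvd k)[q ->]]].
  by apply/ideal_genM/ideal_gen_mem; left; exists x.
apply: ideal_gen_sub => _ [[u /= uw <-]|[u /= uw <-]].
  apply: pos => /ww' uw'.
  suff : 0 <= dot (realvec R (- u)) w by rewrite realvecN dotNl oppr_ge0 leNgt uw.
  apply: (cone_dot_ge0 uw') => i; rewrite inE dot_realvec ler0z dotNl oppr_ge0.
  exact.
have [uw'|uw'] := pselect (dot (realvec R u) w' = 0).
  by apply: ideal_gen_mem; right; exists u.
have notin v : dot (realvec R v) w = 0 -> dot (realvec R v) w' <> 0 ->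
    ~ cone b [set i | (dot v (b i) <= 0)%R]%SET w'.
  move=> vw vw' /ww'[c [c0 wE]]; apply: vw'.
  pose Z := [set i | dot v (b i) == 0]%SET.
  have /ww'[e [_ ->]] : cone b Z w.
    exists c; split=> //; rewrite wE big_mkcond [RHS]big_mkcond /=.
    apply: eq_bigr => i _; rewrite !inE le_eqVlt.
    have [//|_ /=] := eqVneq (dot v (b i)) 0; case: ifP => // vi.
    suff -> : c i = 0 by rewrite scale0r.
    have vi0 : (dot v (b i))%:~R != 0 :> R by rewrite intr_eq0 lt_eqF.
    have : \sum_(j | (dot v (b j) <= 0)) - (c j * (dot v (b j))%:~R) = 0.
      rewrite sumrN; apply/eqP; rewrite oppr_eq0 -[X in _ == X]vw wE dot_sumr.
      apply/eqP; apply: eq_big => j; rewrite ?inE // => _.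
      by rewrite dotZr dot_realvec.
    move=> /psumr_eq0P/(_ i) H; apply/eqP.
    have /eqP : - (c i * (dot v (b i))%:~R) = 0.
      by apply: H => [j vj|]; rewrite ?(ltW vi) // oppr_ge0 mulr_ge0_le0 // lerz0.
    by rewrite oppr_eq0 mulf_eq0 (negPf vi0) orbF.
  rewrite dot_sumr big1 // => i; rewrite inE => /eqP vi.
  by rewrite dotZr dot_realvec vi mulr0.
rewrite /lattice_binomial -pos_monomialN -mulN1r.
apply: ideal_genD; last apply: ideal_genM; apply/pos/notin => //.
  by rewrite realvecN dotNl uw oppr0.
by rewrite realvecN dotNl => /eqP; rewrite oppr_eq0 => /eqP.
Qed.

Theorem theorem1p1 (k : fieldType) (R : realType) (m n : nat)
    (b : 'I_n -> 'rV[int]_m) (b_inj : injective b) (b_sn : supernormal R b) :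
  chamber_complex R b = groebner_fan k R b /\
  (forall w w' : 'rV[R]_m,
     cone b [set: 'I_n]%SET w -> cone b [set: 'I_n]%SET w' ->
     (initial_ideal k b w = initial_ideal k b w' <->
      forall A : {set 'I_n}, cone b A w <-> cone b A w')).
Proof.
have same (w w' : 'rV[R]_m) :
    cone b [set: 'I_n]%SET w -> cone b [set: 'I_n]%SET w' ->
    (initial_ideal k b w = initial_ideal k b w' <->
     forall A : {set 'I_n}, cone b A w <-> cone b A w').
  move=> wB w'B; split=> [ww' A|ww'].
    by split; apply: (@cone_initial_ideal k).
  by apply/seteqP; split; apply: initial_ideal_sub => // A; split=> /ww'.
split=> //; rewrite /chamber_complex /groebner_fan; apply: eq_imagel => w wB.
by apply/seteqP; split=> w' [w'B /(same _ _ wB w'B)].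
Qed.
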